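(* Let $(X,\mathcal{T},E)$ and $(Y,\mathcal{S},E')$ be soft topological spaces and let $f$ be a one-to-one soft function from $(X,\mathcal{T},E)$ onto $(Y,\mathcal{S},E')$. The following are equivalent: (1) $f$ is soft $sw$-open; (2) for each soft closed set $F_E$ over $X$ with $f(F_E)\neq Y_{E'}$, there exists a proper soft closed set $K_{E'}$ over $Y$ (i.e. $K_{E'}\neq Y_{E'}$) such that $f(F_E)\sqsubseteq K_{E'}$.
   Context: A soft set $F_E$ over a set $X$ with parameter set $E$ is a map $F:E\to\mathcal{P}(X)$. The null soft set $\Phi_E$ has all values $\emptyset$; the absolute soft set $X_E$ has all values $X$. Inclusion $\sqsubseteq$, union $\sqcup$, intersection $\sqcap$ and complement are taken parameterwise. A soft topology $\mathcal{T}$ on $X$ is a family of soft sets over $X$ (with parameters $E$) containing $\Phi_E$ and $X_E$ and closed under finite intersections and arbitrary unions; $(X,\mathcal{T},E)$ is a soft topological space, members of $\mathcal{T}$ are soft open and their complements are soft closed. $\mathrm{Int}(F_E)$ is the largest soft open set contained in $F_E$. A soft function $f$ from $X$ (parameters $E$) to $Y$ (parameters $E'$) is given by maps $u:X\to Y$ and $p:E\to E'$; $f(F_E)(e')=\bigcup_{e\in p^{-1}(e')}u(F(e))$ for $e'\in E'$, and $f^{-1}(G_{E'})(e)=u^{-1}(G(p(e)))$ for $e\in E$. It is one-to-one (resp. onto) if both $u$ and $p$ are injective (resp. surjective). A soft set is soft $sw$-open (soft somewhat open) if it is null or its soft interior is non-null. The soft function $f$ is soft $sw$-open if $f(U_E)$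 is soft $sw$-open over $Y$ for each soft open set $U_E$ over $X$. *)

(* Defs.v *)
From mathcomp Require Import all_boot.
From mathcomp Require Import boolp classical_sets functions.

Set Implicit Arguments.
Unset Strict Implicit.
Unset Printing Implicit Defensive.

Local Open Scope classical_set_scope.

Definition softset (X E : Type) : Type := E -> set X.

Section SoftSets.
Variables X E : Type.
Implicit Types F G : softset X E.

Definition null_softset : softset X E := fun=> set0.
Definition absolute_softset : softset X E := fun=> setT.

Definition soft_subset F G : Prop := forall e, F e `<=` G e.
Definition softI F G : softset X E := fun e => F e `&` G e.
Definition softC F : softset X E := fun e => ~` F e.
Definition soft_bigcup (A : set (softset X E)) : softset X E :=
  fun e => \bigcup_(F in A) F e.

End SoftSets.

Arguments null_softset {X E}.
Arguments absolute_softset {X E}.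

(* Closure under all finite intersections is the binary case together with
   membership of the absolute soft set. *)
Record softTopology (X E : Type) := SoftTopology {
  soft_open : set (softset X E);
  soft_open_null : soft_open null_softset;
  soft_open_absolute : soft_open absolute_softset;
  soft_openI : forall F G,
    soft_open F -> soft_open G -> soft_open (softI F G);
  soft_open_bigcup : forall A : set (softset X E),
    A `<=` soft_open -> soft_open (soft_bigcup A)
}.

Section SoftTopologyTheory.
Variables (X E : Type) (T : softTopology X E).
Implicit Types F G : softset X E.

Definition soft_closed F : Prop := soft_open T (softC F).

Definition soft_interior F : softset X E :=
  soft_bigcup [set U | soft_open T U /\ soft_subset U F].

Lemma soft_interior_largest F :
  [/\ soft_open T (soft_interior F), soft_subset (soft_interior F) F &
      forall U, soft_open T U -> soft_subset U F ->
        soft_subset U (soft_interior F)].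
Proof.
split.
- by apply: soft_open_bigcup => U [].
- by move=> e x [U [_ UF] Uex]; exact: UF Uex.
- by move=> U oU UF e x Uex; exists U.
Qed.

Definition soft_sw_open F : Prop :=
  F = null_softset \/ soft_interior F <> null_softset.

End SoftTopologyTheory.

Record softfun (X E Y E' : Type) := SoftFun {
  soft_pt : X -> Y;
  soft_par : E -> E'
}.

Section SoftFunctions.
Variables (X E Y E' : Type) (f : softfun X E Y E').

Definition soft_image (F : softset X E) : softset Y E' :=
  fun e' => \bigcup_(e in soft_par f @^-1` [set e']) (soft_pt f @` F e).

Definition soft_injective : Prop :=
  injective (soft_pt f) /\ injective (soft_par f).

Definition soft_surjective : Prop :=
  set_surj setT setT (soft_pt f) /\ set_surj setT setT (soft_par f).

Definition sw_open_softfun (T : softTopology X E) (S : softTopology Y E') :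
    Prop :=
  forall U, soft_open T U -> soft_sw_open S (soft_image U).

End SoftFunctions.

(* Main.v *)
Require Import Defs.
From mathcomp Require Import all_boot.
From mathcomp Require Import boolp classical_sets functions.

(** Complementation exchanges the two conditions.  A soft set [G] is soft
sw-open exactly when its complement, unless it is absolute, lies in a proper
soft closed set ([soft_sw_openP]): the complements of the proper soft closed
sets containing [softC G] are the non-null soft open sets contained in [G].
Since [f] is bijective on points and on parameters, its image commutes with
complements ([soft_image_softC]), so the condition on [soft_image f U], for
[U] soft open, is the condition on [soft_image f F] for the soft closed set
[F = softC U]. *)

Local Open Scope classical_set_scope.

Lemma softCK (X E : Type) (F : softset X E) : softC (softC F) = F.
Proof. by apply: funext => e; rewrite /softC setCK. Qed.

Lemma softC_absolute (X E : Type) :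
  softC (@absolute_softset X E) = null_softset.
Proof. by apply: funext => e; rewrite /softC setCT. Qed.

Lemma softC_eq_absolute (X E : Type) (F : softset X E) :
  softC F = absolute_softset <-> F = null_softset.
Proof.
rewrite -softC_absolute; split=> [<-|->]; last exact: softCK.
by rewrite softCK.
Qed.

Lemma soft_subsetC (X E : Type) (F G : softset X E) :
  soft_subset F G -> soft_subset (softC G) (softC F).
Proof. by move=> FG e; apply: subsetC; exact: FG. Qed.

Lemma soft_interior_neq_null (X E : Type) (T : softTopology X E)
    (F : softset X E) :
  soft_interior T F <> null_softset <->
  exists U, [/\ soft_open T U, U <> null_softset & soft_subset U F].
Proof.
have [oI IF maxI] := soft_interior_largest T F.
split=> [I0|[U [oU U0 UF]] I0]; first by exists (soft_interior T F).
apply: U0; apply: funext => e; apply/seteqP; split=> // x Uex.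
by have := maxI U oU UF e x Uex; rewrite I0.
Qed.

Lemma soft_sw_openP (X E : Type) (T : softTopology X E) (G : softset X E) :
  soft_sw_open T G <->
  (softC G <> absolute_softset ->
   exists K, [/\ soft_closed T K, K <> absolute_softset &
                 soft_subset (softC G) K]).
Proof.
rewrite softC_eq_absolute /soft_sw_open soft_interior_neq_null.
split=> [[//|[U [oU U0 UG]]] _|H].
  exists (softC U); split; first by rewrite /soft_closed softCK.
  - by rewrite softC_eq_absolute.
  - exact: soft_subsetC.
have [G0|/H[K [cK KT GK]]] := pselect (G = null_softset); first by left.
right; exists (softC K); split=> //.
- by rewrite -softC_eq_absolute softCK.
- by rewrite -[G]softCK; exact: soft_subsetC.
Qed.

Lemma soft_image_softC (X E Y E' : Type) (f : softfun X E Y E')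
    (F : softset X E) :
  soft_injective f -> soft_surjective f ->
  soft_image f (softC F) = softC (soft_image f F).
Proof.
move=> [u_inj p_inj] [u_surj p_surj]; apply: funext => e'.
apply/seteqP; split=> y.
  move=> [e /= pe [x Fx <-]] [e1 /= pe1 [x1 Fx1 /u_inj xx1]].
  by apply: Fx; rewrite -xx1 (p_inj e e1) // pe pe1.
move=> nFy; have [e _ pe] := p_surj e' I; have [x _ ux] := u_surj y I.
by exists e => //; exists x => // Fx; apply: nFy; exists e => //; exists x.
Qed.

Theorem theorem5p4 (X E Y E' : Type)
    (T : softTopology X E) (S : softTopology Y E') (f : softfun X E Y E')
    (f_inj : soft_injective f) (f_surj : soft_surjective f) :
  sw_open_softfun f T S <->
  (forall F : softset X E,
     soft_closed T F -> soft_image f F <> absolute_softset ->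
     exists K : softset Y E',
       [/\ soft_closed S K, K <> absolute_softset &
           soft_subset (soft_image f F) K]).
Proof.
split=> [sw_f F cF | H U oU].
  have /soft_sw_openP := sw_f _ cF.
  by rewrite -soft_image_softC // softCK.
apply/soft_sw_openP; rewrite -soft_image_softC //; apply: H.
by rewrite /soft_closed softCK.
Qed.
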